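(* Let $R$ be a ring and $G$ a group. If the group ring $RG$ is a generalized fine ring, then $R$ is generalized fine and $G$ is a $p$-group, for some prime $p$, with $p \in J(R)$.
   Context: Rings are arbitrary associative rings with identity, not necessarily commutative. For a ring $R$, $J(R)$ is its Jacobson radical. A ring $R$ is called generalized fine if every element of $R$ outside $J(R)$ can be expressed as a sum of a unit and a nilpotent element of $R$. $RG$ denotes the group ring of $G$ over $R$. For a prime $p$, a group $G$ is called a $p$-group if every element of $G$ has finite order which is a power of $p$. In $p \in J(R)$, $p$ denotes the element $p \cdot 1_R$ of $R$.
   Formalization: R is taken to be a nonzero ring, and the claim that G is a p-group with p in J(R) is made only for nontrivial G; for trivial G it fails (R = Q: RG = Q is generalized fine but J(Q) = 0), and for R = 0 it fails with G = Z/6. *)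

(* Defs.v *)
From HB Require Import structures.
From mathcomp Require Import all_boot all_algebra finmap.
From mathcomp.multinomials Require Import monalg.
From mathcomp Require Import boolp classical_sets.

Set Implicit Arguments.
Unset Strict Implicit.
Unset Printing Implicit Defensive.

Import GRing.Theory.
Local Open Scope classical_set_scope.
Local Open Scope fset_scope.
Local Open Scope ring_scope.

(* The group G is arbitrary (possibly infinite, non-abelian). The library's  *)
(* ring structure on {malg R[K]} requires an index monoid K in which only 1  *)
(* is invertible, which rules groups out: only its additive structure (that  *)
(* of the finitely supported functions) is reused, on an alias of the type.  *)
Definition group_ring (R : nzRingType) (G : groupType) : Type := {malg R[G]}.

HB.instance Definition _ (R : nzRingType) (G : groupType) :=
  GRing.Zmodule.on (group_ring R G).

Section GroupRing.
Variables (R : nzRingType) (G : groupType).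
Implicit Types (a b c : {malg R[G]}) (x y : R) (g h : G).

Definition gr_one : {malg R[G]} := << 1 *g 1%g >>.

Definition gr_mul a b : {malg R[G]} :=
  \sum_(g <- msupp a) \sum_(h <- msupp b) << a@_g * b@_h *g (g * h)%g >>.

Lemma gr_mulw (d1 d2 : {fset G}) a b :
  msupp a `<=` d1 -> msupp b `<=` d2 ->
  gr_mul a b = \sum_(g <- d1) \sum_(h <- d2) << a@_g * b@_h *g (g * h)%g >>.
Proof.
move=> le_d1 le_d2; rewrite /gr_mul (big_fset_incl _ le_d1) /=.
  apply/eq_bigr=> g _; apply/big_fset_incl => // h _ /mcoeff_outdom ->.
  by rewrite mulr0 monalgU0.
move=> g _ /mcoeff_outdom ag.
by rewrite big1 => // h _; rewrite ag mul0r monalgU0.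
Qed.

Lemma gr_mulUU x y g h :
  gr_mul << x *g g >> << y *g h >> = << x * y *g (g * h)%g >>.
Proof. by rewrite (gr_mulw msuppU_le msuppU_le) !big_seq_fset1 !mcoeffUU. Qed.

Lemma gr_mulDl : left_distributive gr_mul +%R.
Proof.
move=> a b c.
rewrite (gr_mulw (msuppD_le a b) (fsubset_refl _)).
rewrite (gr_mulw (fsubsetUl (msupp a) (msupp b)) (fsubset_refl _)).
rewrite (gr_mulw (fsubsetUr (msupp a) (msupp b)) (fsubset_refl _)).
rewrite -big_split /=; apply/eq_bigr=> g _.
rewrite -big_split /=; apply/eq_bigr=> h _.
by rewrite mcoeffD mulrDl monalgUD.
Qed.

Lemma gr_mulDr : right_distributive gr_mul +%R.
Proof.
move=> c a b.
rewrite (gr_mulw (fsubset_refl _) (msuppD_le a b)).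
rewrite (gr_mulw (fsubset_refl _) (fsubsetUl (msupp a) (msupp b))).
rewrite (gr_mulw (fsubset_refl _) (fsubsetUr (msupp a) (msupp b))).
rewrite -big_split /=; apply/eq_bigr=> g _.
rewrite -big_split /=; apply/eq_bigr=> h _.
by rewrite mcoeffD mulrDr monalgUD.
Qed.

Lemma gr_mul0l : left_zero 0 gr_mul.
Proof. by move=> a; rewrite /gr_mul msupp0 big_seq_fset0. Qed.

Lemma gr_mul0r : right_zero 0 gr_mul.
Proof. by move=> a; rewrite /gr_mul big1 // => g _; rewrite msupp0 big_seq_fset0. Qed.

Lemma gr_mul_suml (I : Type) (r : seq I) (F : I -> {malg R[G]}) b :
  gr_mul (\sum_(i <- r) F i) b = \sum_(i <- r) gr_mul (F i) b.
Proof. exact: (big_morph (gr_mul^~ b) (fun _ _ => gr_mulDl _ _ _) (gr_mul0l b)). Qed.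

Lemma gr_mul_sumr (I : Type) (r : seq I) (F : I -> {malg R[G]}) a :
  gr_mul a (\sum_(i <- r) F i) = \sum_(i <- r) gr_mul a (F i).
Proof. exact: (big_morph (gr_mul a) (fun _ _ => gr_mulDr _ _ _) (gr_mul0r a)). Qed.

Lemma gr_mul1l : left_id gr_one gr_mul.
Proof.
move=> a; rewrite {1}(monalgE a) gr_mul_sumr [RHS]monalgE.
by apply/eq_bigr=> g _; rewrite gr_mulUU mul1r mul1g.
Qed.

Lemma gr_mul1r : right_id gr_one gr_mul.
Proof.
move=> a; rewrite {1}(monalgE a) gr_mul_suml [RHS]monalgE.
by apply/eq_bigr=> g _; rewrite gr_mulUU mulr1 mulg1.
Qed.

Lemma gr_mulA : associative gr_mul.
Proof.
move=> a b c; rewrite (monalgE a) !gr_mul_suml; apply/eq_bigr=> g _.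
rewrite (monalgE b) gr_mul_suml !gr_mul_sumr gr_mul_suml.
apply/eq_bigr=> h _; rewrite (monalgE c) !gr_mul_sumr.
by apply/eq_bigr=> k _; rewrite !gr_mulUU mulrA mulgA.
Qed.

Lemma gr_one_neq0 : gr_one != 0.
Proof. by rewrite monalgU_eq0 oner_eq0. Qed.

HB.instance Definition _ := GRing.Zmodule_isNzRing.Build (group_ring R G)
  gr_mulA gr_mul1l gr_mul1r gr_mulDl gr_mulDr gr_one_neq0.

End GroupRing.

Section RingNotions.
Variable R : nzRingType.
Implicit Types (I M : set R) (x u v a : R).

Definition left_ideal I : Prop :=
  [/\ I 0, forall x y, I x -> I y -> I (x + y) & forall a x, I x -> I (a * x)].

Definition maximal_left_ideal M : Prop :=
  [/\ left_ideal M, M <> setT &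
      forall I, left_ideal I -> (M `<=` I)%classic -> I = M \/ I = setT].

Definition jacobson_radical : set R :=
  \bigcap_(M in maximal_left_ideal) M.

(* GRing.unit is only available for rings with decidable units. *)
Definition is_unit u : Prop := exists v, v * u = 1 /\ u * v = 1.

Definition nilpotent_element x : Prop := exists n : nat, x ^+ n = 0.

Definition generalized_fine : Prop :=
  forall x, ~ jacobson_radical x ->
    exists u v, [/\ is_unit u, nilpotent_element v & x = u + v].

End RingNotions.

Arguments jacobson_radical R : clear implicits.
Arguments generalized_fine R : clear implicits.

Definition has_order (G : groupType) (g : G) (n : nat) : Prop :=
  [/\ (0 < n)%N, (g ^+ n = 1)%g &
      forall m : nat, (0 < m)%N -> (g ^+ m = 1)%g -> (n <= m)%N].

(* The group G may be infinite, unlike in pgroup.v. *)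
Definition is_pgroup (p : nat) (G : groupType) : Prop :=
  forall g : G, exists k : nat, has_order g (p ^ k)%N.

(* Main.v *)
Require Import Defs.
From HB Require Import structures.
From mathcomp Require Import all_boot all_algebra finmap.
From mathcomp.multinomials Require Import monalg.
From mathcomp Require Import boolp classical_sets.

Set Implicit Arguments.
Unset Strict Implicit.
Unset Printing Implicit Defensive.

Import GRing.Theory.
Local Open Scope ring_scope.

(* A proper two-sided ideal of a generalized fine ring lies in the Jacobson
   radical: modulo such an ideal, a unit cannot equal a nilpotent element.
   Applied to the augmentation ideal of RG, this puts 1 - g in J(RG) for every
   g in G, so every element of augmentation 1 is left invertible.
   - If g had infinite order, a left inverse v of 1 - g + g^2 would satisfy
     v (1 + g^3) = 1 + g; comparing coefficients along the powers of g^3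
     contradicts the finiteness of the support of v.
   - If g <> 1 and g^n = 1, then n lies in J(RG): otherwise the ideal n RG is
     everything, n is invertible, and 1 + g + ... + g^(n-1), which has
     augmentation n, is left invertible although it annihilates 1 - g.
   Applying the second point to suitable powers of g, every prime dividing the
   order of an element lies in J(RG), hence in J(R) as the augmentation is onto,
   and J(R) contains at most one prime. *)

(** * Left ideals and the Jacobson radical *)

Lemma left_idealB (R : nzRingType) (I : set R) x y :
  left_ideal I -> I x -> I y -> I (x - y).
Proof. by case=> _ ID IM Ix Iy; apply: ID => //; rewrite -mulN1r; apply: IM. Qed.

Lemma left_ideal_jacobson (R : nzRingType) : left_ideal (jacobson_radical R).
Proof.
split=> [M [[]] //|x y Jx Jy M mM|a x Jx M mM]; have [[_ MD MM] _ _] := mM.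
- by apply: MD; [apply: Jx|apply: Jy].
- by apply: MM; apply: Jx.
Qed.

(** Zorn's lemma, applied to the left ideals that contain [x] but not 1. *)
Lemma maximal_left_ideal_exists (R : nzRingType) (x : R) :
  ~ (exists w, w * x = 1) -> exists2 M, maximal_left_ideal M & M x.
Proof.
move=> noinv; pose good (I : set R) := [/\ left_ideal I, I x & ~ I 1].
(* The empty set is admitted because [Zorn_bigcup] includes the empty chain. *)
have [|A [PA maxA]] := @Zorn_bigcup R (fun I => I = set0 \/ good I).
  move=> F FP totF; have goodF X z : F X -> X z -> good X.
    by move=> /FP[->|].
  have [[z [X FX Xz]]|none] := pselect (exists z, (\bigcup_(X in F) X)%classic z); last first.
    by left; apply/seteqP; split=> z // Uz; case: none; exists z.
  have [[X0 _ _] Xx _] := goodF _ _ FX Xz; right; split; last 2 first.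
  - by exists X.
  - by move=> [Y FY Y1]; have [_ _] := goodF _ _ FY Y1; apply.
  split=> [|a b [Y FY Ya] [Z FZ Zb]|a b [Y FY Yb]]; first by exists X.
    have [[_ YD _] _ _] := goodF _ _ FY Ya.
    have [[_ ZD _] _ _] := goodF _ _ FZ Zb.
    case: (totF Y Z FY FZ) => sYZ.
      by exists Z => //; apply: ZD => //; apply: sYZ.
    by exists Y => //; apply: YD => //; apply: sYZ.
  by have [[_ _ YM] _ _] := goodF _ _ FY Yb; exists Y => //; apply: YM.
(* The principal left ideal [Rx] shows that the empty set is not maximal. *)
pose Rx : set R := fun z => exists w, z = w * x.
have goodRx : good Rx.
  split; [split | by exists 1; rewrite mul1r |].
  - by exists 0; rewrite mul0r.
  - by move=> _ _ [a ->] [b ->]; exists (a + b); rewrite mulrDl.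
  - by move=> a _ [b ->]; exists (a * b); rewrite mulrA.
  - by move=> [w wx]; apply: noinv; exists w.
case: PA => [A0|[AI Ax A1]].
  have : ~ (Rx = set0 \/ good Rx); last by case; right.
  apply: maxA; rewrite A0; split=> [z //|/(_ x)]; apply.
  by exists 1; rewrite mul1r.
exists A => //; split=> // [AT|I II sAI]; first by apply: A1; rewrite AT.
have [I1|I1] := pselect (I 1).
  by right; apply/seteqP; split=> z // _; have [_ _ IM] := II;
     rewrite -[z]mulr1; apply: IM.
left; apply/seteqP; split=> // z Iz; apply: contrapT => Az.
apply: (maxA I); first by split=> // /(_ z Iz).
by right; split=> //; apply: sAI.
Qed.

(** Otherwise some maximal left ideal contains [1 - j]; it also contains [j], hence 1. *)
Lemma jacobson_left_inverse (R : nzRingType) (j : R) :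
  jacobson_radical R j -> exists w, w * (1 - j) = 1.
Proof.
move=> Jj; apply: contrapT => /maximal_left_ideal_exists[M mM Mx].
have [MI MT _] := mM; have [_ MD MM] := MI; apply: MT.
have M1 : M 1 by rewrite -(subrK j 1); apply: MD => //; apply: Jj.
by apply/seteqP; split=> z // _; rewrite -[z]mulr1; apply: MM.
Qed.

Lemma jacobson_proper (R : nzRingType) : ~ jacobson_radical R 1.
Proof.
move=> /jacobson_left_inverse[w]; rewrite subrr mulr0 => /esym/eqP.
by rewrite oner_eq0.
Qed.

Lemma jacobson_coprime (R : nzRingType) m n :
  coprime m n -> jacobson_radical R m%:R -> ~ jacobson_radical R n%:R.
Proof.
move=> co Jm Jn; have JI := left_ideal_jacobson R; have [_ _ JM] := JI.
(* Bezout needs a positive [m]; if [m] is 0, coprimality forces [n = 1]. *)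
case: m => [|m] in co Jm *.
  by move: co Jn; rewrite /coprime gcd0n => /eqP->; apply: jacobson_proper.
have [km kn E _] := egcdnP n (ltn0Sn m); apply: (@jacobson_proper R).
have -> : 1 = km%:R * m.+1%:R - kn%:R * n%:R :> R.
  by rewrite -!natrM E (eqP co) natrD addrC addKr.
by apply: (left_idealB JI); apply: JM.
Qed.

(** Preimages of maximal left ideals under [f] are maximal. The section [s] need not be additive: it
    only witnesses surjectivity. *)
Lemma jacobson_surj (A B : nzRingType) (f : {rmorphism A -> B}) (s : B -> A) x :
  cancel s f -> jacobson_radical A x -> jacobson_radical B (f x).
Proof.
move=> sK Jx M mM; have [MI MT maxM] := mM; have [M0 MD MM] := MI.
apply: (Jx (fun a => M (f a))); split=> [|E|I II sMI].
- split=> [|a b|a b] /=; rewrite ?rmorph0 ?rmorphD ?rmorphM //.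
    exact: MD.
  exact: MM.
- apply: MT; apply/seteqP; split=> b // _; rewrite -(sK b).
  by have : [set: A]%classic (s b) by []; rewrite -E.
have [I0 ID IM] := II.
(* The image of [I] contains [M], so it is [M] or [B]; in the latter case [I] is [A], because [I]
   contains the kernel of [f]. *)
pose fI : set B := fun b => exists2 a, I a & f a = b.
have fII : left_ideal fI.
  split=> [|_ _ [a Ia <-] [b Ib <-]|b _ [a Ia <-]].
  - by exists 0 => //; rewrite rmorph0.
  - by exists (a + b); [apply: ID|rewrite rmorphD].
  - by exists (s b * a); [apply: IM|rewrite rmorphM sK].
have sMfI : (M `<=` fI)%classic.
  by move=> b Mb; exists (s b); [apply: sMI; rewrite sK|rewrite sK].
case: (maxM fI fII sMfI) => E.
  by left; apply/seteqP; split=> a; [move=> Ia; rewrite -E; exists a|apply: sMI].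
right; apply/seteqP; split=> a // _; have [i Ii fi] : fI (f a) by rewrite E.
rewrite -(subrK i a); apply: ID => //; apply: sMI.
by rewrite rmorphB fi subrr.
Qed.

Lemma generalized_fine_surj (A B : nzRingType) (f : {rmorphism A -> B}) (s : B -> A) :
  cancel s f -> generalized_fine A -> generalized_fine B.
Proof.
move=> sK gfA x Jx; have [|u [v [[w [wu uw]] [n vn] E]]] := gfA (s x).
  by move=> /(jacobson_surj sK); rewrite sK.
exists (f u), (f v); split; last by rewrite -rmorphD -E sK.
- by exists (f w); rewrite -!rmorphM wu uw rmorph1.
- by exists n; rewrite -rmorphXn vn rmorph0.
Qed.

Lemma proper_ideal_sub_jacobson (R : nzRingType) (I : set R) :
    generalized_fine R -> left_ideal I -> (forall a x, I x -> I (x * a)) ->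
  ~ I 1 -> (I `<=` jacobson_radical R)%classic.
Proof.
move=> gfR II IMr I1 x Ix; apply: contrapT => /gfR[u [v [[w [wu _]] [n vn] E]]].
have [I0 ID IM] := II.
(* Modulo [I], [u] equals [- v], hence so do their powers; nilpotence then puts [u ^+ n] in [I], and
   multiplying by [w] repeatedly brings it down to 1. *)
have cong k : I (u ^+ k - (- v) ^+ k).
  elim: k => [|k IHk]; first by rewrite !expr0 subrr.
  have -> : u ^+ k.+1 - (- v) ^+ k.+1
            = u * (u ^+ k - (- v) ^+ k) + x * (- v) ^+ k.
    by rewrite E !exprS mulrBr mulrDl mulNr opprK addrA subrK.
  by apply: ID; [apply: IM|apply: IMr].
have : I (u ^+ n) by have := cong n; rewrite exprNn vn mulr0 subr0.
apply/contra_not: I1; elim: n {vn} => [|n IHn]; first by rewrite expr0.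
by move=> /(IM w); rewrite exprS mulrA wu mul1r.
Qed.

(** * Augmentation and coefficients in the group ring *)

Section Augmentation.
Variables (R : nzRingType) (G : groupType).

Definition augmentation : group_ring R G -> R := mmap idfun (fun=> 1).

Lemma augmentationU x (g : G) : augmentation << x *g g >> = x.
Proof. by rewrite /augmentation mmapU mulr1. Qed.

HB.instance Definition _ := GRing.Additive.on augmentation.

Lemma augmentation_monoid_morphism : monoid_morphism augmentation.
Proof.
split=> [|a b]; first exact: augmentationU.
rewrite {1}/GRing.mul /= /gr_mul raddf_sum mulr_suml; apply: eq_bigr => g _.
rewrite raddf_sum mulr_sumr /=; apply: eq_bigr => h _.
by rewrite augmentationU !mulr1.
Qed.

HB.instance Definition _ :=
  GRing.isMonoidMorphism.Build (group_ring R G) R augmentation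
    augmentation_monoid_morphism.

Definition group_elt (g : G) : group_ring R G := << 1 *g g >>.

Lemma augmentation_group_elt g : augmentation (group_elt g) = 1.
Proof. exact: augmentationU. Qed.

Lemma group_eltM g h : group_elt (g * h)%g = group_elt g * group_elt h.
Proof. by rewrite [RHS]gr_mulUU mulr1. Qed.

Lemma group_eltX g n : group_elt (g ^+ n)%g = group_elt g ^+ n.
Proof. by elim: n => [//|n IHn]; rewrite exprS expgS group_eltM IHn. Qed.

Lemma mcoeff_mul_group_elt (v : group_ring R G) g h :
  mcoeff h (v * group_elt g) = mcoeff (h * g^-1)%g v.
Proof.
have -> : v * group_elt g = \sum_(k <- msupp v) << mcoeff k v *g (k * g)%g >>.
  transitivity (gr_mul (\sum_(k <- msupp v) << mcoeff k v *g k >>) (group_elt g)).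
    by rewrite -monalgE.
  by rewrite gr_mul_suml; apply: eq_bigr => k _; rewrite gr_mulUU mulr1.
rewrite [in RHS](monalgE v) !raddf_sum; apply: eq_bigr => k _ /=.
rewrite !mcoeffU; congr (_ *+ nat_of_bool _).
by apply/eqP/eqP => [<-|->]; rewrite ?mulgK ?mulgVK.
Qed.

Lemma mcoeff_group_elt g h : mcoeff h (group_elt g) = (g == h)%:R.
Proof. exact: mcoeffU. Qed.

(** Pigeonhole: [N + 1] distinct values cannot all lie in a support of size [N]. *)
Lemma mcoeff_injective_eq0 (v : group_ring R G) (f : nat -> G) :
  injective f -> exists n, mcoeff (f n) v = 0.
Proof.
move=> injf; apply: contrapT => nz; set N := #|` msupp v|.
have U : uniq [seq f i | i <- iota 0 N.+1] by rewrite map_inj_uniq ?iota_uniq.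
have sub : {subset [seq f i | i <- iota 0 N.+1] <= msupp v}.
  move=> _ /mapP[n _ ->]; rewrite -mcoeff_neq0; apply/eqP => E.
  by apply: nz; exists n.
by have := uniq_leq_size U sub; rewrite size_map size_iota ltnn.
Qed.

End Augmentation.

(** * Radical and torsion when RG is generalized fine *)

Section GeneralizedFineGroupRing.
Variables (R : nzRingType) (G : groupType).
Hypothesis gfRG : generalized_fine (group_ring R G).
Local Notation RG := (group_ring R G).
Local Notation aug := (@augmentation R G).
Local Notation elt := (@group_elt R G).

Lemma augmentation_constK : cancel (fun x : R => << x *g 1%g >> : RG) aug.
Proof. by move=> x; rewrite augmentationU. Qed.

Lemma augmentation0_jacobson (a : RG) : aug a = 0 -> jacobson_radical RG a.
Proof.
apply: (proper_ideal_sub_jacobson (I := fun a => aug a = 0)) => //.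
- split=> [|x y|x y] /=; first exact: rmorph0.
    by rewrite rmorphD /= => -> ->; rewrite addr0.
  by rewrite rmorphM /= => ->; rewrite mulr0.
- by move=> x y; rewrite rmorphM /= => ->; rewrite mul0r.
- by rewrite rmorph1 => /eqP; rewrite oner_eq0.
Qed.

Lemma augmentation1_left_inverse (a : RG) : aug a = 1 -> exists w, w * a = 1.
Proof.
move=> a1; rewrite -[a](subKr 1); apply: jacobson_left_inverse.
by apply: augmentation0_jacobson; rewrite rmorphB rmorph1 /= a1 subrr.
Qed.

Lemma torsion_exponent_jacobson (g : G) n :
  g <> 1%g -> (g ^+ n)%g = 1%g -> jacobson_radical R n%:R.
Proof.
move=> g1 gn; rewrite -(rmorph_nat aug); apply: (jacobson_surj augmentation_constK).
apply: contrapT => Jn.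
have [y yn] : exists y : RG, y * n%:R = 1.
  apply: contrapT => noy; apply: Jn.
  apply: (proper_ideal_sub_jacobson (I := fun a => exists y : RG, a = y * n%:R)) => //.
  - split=> [|_ _ [a ->] [b ->]|a _ [b ->]]; first by exists 0; rewrite mul0r.
      by exists (a + b); rewrite mulrDl.
    by exists (a * b); rewrite mulrA.
  - by move=> a _ [b ->]; exists (b * a); rewrite -!mulrA (commr_nat a n).
  - by move=> [y y1]; apply: noy; exists y.
  - by exists 1; rewrite mul1r.
(* A geometric sum, so [N * (elt g - 1)] telescopes to 0, while [y * N] has augmentation 1 and hence
   a left inverse. *)
pose N : RG := \sum_(i < n) elt g ^+ i.
have augN : aug N = n%:R.
  rewrite rmorph_sum -[n in RHS]card_ord -sumr_const; apply: eq_bigr => i _.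
  by rewrite rmorphXn /= augmentation_group_elt expr1n.
have [w wyN] : exists w, w * (y * N) = 1.
  apply: augmentation1_left_inverse.
  by rewrite rmorphM /= augN -(rmorph_nat aug) -rmorphM yn rmorph1.
have Ng : N * (elt g - 1) = 0.
  have comN : GRing.comm (elt g - 1) N.
    apply: commr_sum => i _; apply: commrX; apply: commr_sym.
    by apply: commrB; [apply: commr_refl|apply: commr1].
  by rewrite -comN -subrX1 -group_eltX gn subrr.
have : elt g - 1 = 0 by rewrite -[LHS]mul1r -{1}wyN -!mulrA Ng !mulr0.
move/(congr1 (mcoeff 1%g)); rewrite mcoeffB (mcoeff_group_elt R g) mcoeff0.
rewrite (mcoeff_group_elt R 1%g) eqxx; case: eqP => // _ /eqP.
by rewrite sub0r oppr_eq0 oner_eq0.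
Qed.

Lemma expg_inj_aperiodic (h : G) :
  (forall n, (0 < n)%N -> (h ^+ n)%g <> 1%g) -> injective (fun n => (h ^+ n)%g).
Proof.
move=> aper; suff lt i j : (i < j)%N -> (h ^+ i)%g <> (h ^+ j)%g.
  by move=> i j E; case: (ltngtP i j) => // /lt; rewrite E.
move=> ij E; apply: (aper (j - i)%N); first by rewrite subn_gt0.
by rewrite expgnFr ?(ltnW ij) // E mulgV.
Qed.

Lemma group_periodic (g : G) : exists n, (0 < n)%N && (g ^+ n == 1)%g.
Proof.
apply: contrapT => inf.
have aper n : (g ^+ n.+1)%g <> 1%g by move=> gn; apply: inf; exists n.+1; apply/eqP.
(* The cube comes from (1 - g + g^2)(1 + g) = 1 + g^3. *)
pose c := (g ^+ 3)%g.
have cX n : (c ^+ n.+1 = g ^+ (3 * n).+3)%g by rewrite -expgnA mulnS.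
have cXV n : (c^-1 ^+ n.+1 = (g ^+ (3 * n).+3)^-1)%g by rewrite expVgn cX.
have cinj : injective (fun n => (c ^+ n)%g).
  by apply: expg_inj_aperiodic => -[//|n] _; rewrite cX.
have cVinj : injective (fun n => (c^-1 ^+ n.+1)%g).
  move=> m n /=; rewrite !expVgn => /invg_inj /cinj; exact: succn_inj.
have [v vu] : exists v, v * (1 - elt g + elt g ^+ 2) = 1.
  apply: augmentation1_left_inverse.
  rewrite rmorphD rmorphB rmorphXn rmorph1 /= augmentation_group_elt.
  by rewrite expr1n subrr add0r.
have vc : v * (1 + elt c) = 1 + elt g.
  transitivity (v * (1 - elt g + elt g ^+ 2) * (1 + elt g)); last by rewrite vu mul1r.
  rewrite -mulrA group_eltX; congr (_ * _).
  rewrite mulrDr mulr1 !mulrDl mulNr mul1r -expr2 -exprSr addrA.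
  by rewrite addrACA subrK subrr addr0.
have rec h : mcoeff h v + mcoeff (h * c^-1)%g v = (1%g == h)%:R + (g == h)%:R.
  rewrite -mcoeff_mul_group_elt -mcoeffD.
  have -> : v + v * elt c = elt 1%g + elt g by rewrite -vc mulrDr mulr1.
  by rewrite mcoeffD (mcoeff_group_elt R 1%g) (mcoeff_group_elt R g).
(* No positive power of [c] is 1 or [g], so by [rec] a vanishing coefficient at one power of [c]
   descends to the previous one, down to 1. *)
have v1 : mcoeff 1%g v = 0.
  have [n] := mcoeff_injective_eq0 v cinj; elim: n => [//|n IHn] vn; apply: IHn.
  have := rec (c ^+ n.+1)%g; rewrite vn add0r expgSr mulgK -expgSr => ->.
  rewrite cX; case: eqP => [/esym/aper//|_]; case: eqP => [E|]; last by rewrite addr0.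
  by case: (aper (3 * n).+1); apply: (mulgI g); rewrite -expgS mulg1.
have vcV : mcoeff (c^-1)%g v = 1.
  have := rec 1%g; rewrite v1 add0r mul1g eqxx => ->.
  by case: eqP => [E|]; [case: (aper 0%N)|rewrite addr0].
(* The same descent along negative powers ends at [c^-1], where the coefficient is 1. *)
have [n] := mcoeff_injective_eq0 v cVinj; elim: n => [|n IHn] vn.
  by move: vn; rewrite expg1 vcV => /eqP; rewrite oner_eq0.
apply: IHn; have := rec (c^-1 ^+ n.+1)%g; rewrite -expgSr vn addr0 => ->.
rewrite cXV; case: eqP => [E|_].
  by case: (aper (3 * n).+2); rewrite -[LHS]invgK -E invg1.
case: eqP => [E|]; last by rewrite addr0.
by case: (aper (3 * n).+3); rewrite expgS {1}E mulVg.
Qed.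

End GeneralizedFineGroupRing.

(* The guard on the second conjunct excludes the trivial group, which is a
   p-group for every p although no prime need lie in J(R) (e.g. R a field of
   characteristic 0). *)
Theorem theorem4p2 (R : nzRingType) (G : groupType)
    (hRG : generalized_fine (group_ring R G)) :
  generalized_fine R /\
  ((exists g : G, g <> 1%g) ->
   exists p : nat, [/\ prime p, is_pgroup p G & jacobson_radical R p%:R]).
Proof.
split; first exact: generalized_fine_surj (@augmentation_constK R G) hRG.
have ord (g : G) : exists n, has_order g n.
  case: (ex_minnP (group_periodic hRG g)) => n /andP[n0 /eqP gn] minn.
  by exists n; split=> // m m0 gm; apply: minn; rewrite m0; apply/eqP.
have prime_divisor_jac (g : G) n q : has_order g n -> prime q -> (q %| n)%N ->
    jacobson_radical R q%:R.
  move=> [n0 gn minn] pq qn; have n_q : (n %/ q < n)%N by rewrite ltn_Pdiv ?prime_gt1.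
  have nq0 : (0 < n %/ q)%N by rewrite divn_gt0 ?prime_gt0 // dvdn_leq.
  (* This power of [g] is nontrivial by minimality of [n], and its [q]-th power is 1. *)
  apply: (torsion_exponent_jacobson hRG (g := (g ^+ (n %/ q))%g)).
    by move=> /(minn _ nq0); rewrite leqNgt n_q.
  by rewrite -expgnA divnK.
move=> [g g1]; have [n on] := ord g.
have n1 : (1 < n)%N.
  by case: on => + + _; case: n => [//|[|//]] _; rewrite expg1 => /g1.
have pp := pdiv_prime n1; have Jp := prime_divisor_jac _ _ _ on pp (pdiv_dvd n).
exists (pdiv n); split=> // h; have [m om] := ord h.
suff /p_natP[k mk] : (pdiv n).-nat m by exists k; rewrite -mk.
(* A prime divisor [q] of [m] other than [pdiv n] would give two coprime integers in J(R). *)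
have [m0 _ _] := om; apply/pnatP => // q pq qm; rewrite !inE; apply: contrapT => qp.
apply: (jacobson_coprime _ Jp (prime_divisor_jac _ _ _ om pq qm)).
by rewrite prime_coprime // dvdn_prime2 // eq_sym; apply/negP.
Qed.
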